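(* The Erdős–Hajnal coefficient of the directed path $P_k$ satisfies $$\epsilon(P_k)=\frac{1}{k^{1+o(1)}}\qquad\text{as } k\to\infty.$$
   Context: All graphs are finite and simple. A tournament is a directed graph in which for every two distinct vertices $u,v$ exactly one of $(u,v),(v,u)$ is an edge. A tournament is transitive if it contains no directed cycle. A tournament $T$ is $H$-free if it has no induced subtournament isomorphic to $H$. The directed path $P_k$ is the tournament with vertex set $\{v_1,\dots,v_k\}$ in which, for $1\le i<j\le k$, the edge between $v_i$ and $v_j$ is $(v_j,v_i)$ if $j=i+1$ and $(v_i,v_j)$ otherwise. For a tournament $H$, the Erdős–Hajnal coefficient $\epsilon(H)$ is the supremum of all $\epsilon\ge 0$ such that every $H$-free tournament $T$ (with at least one vertex) contains a transitive subtournament of order at least $|T|^{\epsilon}$, where $|T|$ is the number of vertices of $T$. *)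

(* Defs.v *)
From mathcomp Require Import all_boot all_order all_algebra.
From mathcomp Require Import all_classical all_reals all_analysis.
Set Implicit Arguments.
Unset Strict Implicit.
Unset Printing Implicit Defensive.
Import Order.TTheory GRing.Theory Num.Theory.
Local Open Scope ring_scope.
Local Open Scope classical_set_scope.

Record tournament := Tournament {
  vertex :> finType;
  edge : rel vertex;
  edge_irr : irreflexive edge;
  edge_xor : forall u v, u != v -> edge u v (+) edge v u }.

Section Induced.
Variables (T : tournament) (S : {set T}).

Definition induced_edge : rel {x : T | x \in S} := fun u v => edge (val u) (val v).

Lemma induced_edge_irr : irreflexive induced_edge.
Proof. by move=> u; exact: edge_irr. Qed.

Lemma induced_edge_xor u v : u != v -> induced_edge u v (+) induced_edge v u.
Proof. by move=> uv; apply: edge_xor; rewrite (inj_eq val_inj). Qed.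

Definition induced : tournament := Tournament induced_edge_irr induced_edge_xor.
End Induced.

Definition tournament_iso (H T : tournament) : Prop :=
  exists f : H -> T, bijective f /\ forall u v, edge (f u) (f v) = edge u v.

Definition tournament_free (H T : tournament) : Prop :=
  forall S : {set T}, ~ tournament_iso (induced S) H.

Definition transitive_tournament (T : tournament) : Prop :=
  ~ exists c : seq T, c != [::] /\ ucycle (@edge T) c.

Section PathTournament.
Variable k : nat.

(* Vertices are numbered from 0: [i : 'I_k] stands for v_(i+1). *)
Definition path_edge : rel 'I_k := fun i j =>
  if (i < j)%N then nat_of_ord j != i.+1 else nat_of_ord i == j.+1.

Lemma path_edge_irr : irreflexive path_edge.
Proof. by move=> i; rewrite /path_edge ltnn -[_ == _]negbK neq_ltn ltnS leqnn. Qed.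

Lemma path_edge_xor i j : i != j -> path_edge i j (+) path_edge j i.
Proof.
rewrite /path_edge -val_eqE /= neq_ltn.
by case: ltngtP => //= _ _; case: eqP.
Qed.

Definition path_tournament : tournament := Tournament path_edge_irr path_edge_xor.
End PathTournament.

(* The supremum is taken in \bar R because it can be +oo, e.g. when H has at
   most two vertices. *)
Definition EH_coefficient (R : realType) (H : tournament) : \bar R :=
  ereal_sup (EFin @` [set e : R | 0 <= e /\
    forall T : tournament, (0 < #|T|)%N -> tournament_free H T ->
      exists S : {set T}, transitive_tournament (induced S) /\
        #|T|%:R `^ e <= #|S|%:R :> R]).

(* Main.v *)
(** Let [n = |T|].

    Upper bound: a random tournament on [2^s] vertices has no transitive
    subtournament of order [2 s + 2]; since [P_k] contains a transitive
    subtournament of order [k/2], it is [P_k]-free for [s ~ k/4], so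
    [epsilon(P_k) = O(log k / k)].

    Lower bound: let [T] be [P_k]-free.  Trying to embed [P_k] vertex by vertex
    shows that every vertex set [U] contains sets [A], [B] of size
    [|U| k^(-O(k))] such that only a [1 / poly k] fraction of the pairs point
    from [B] to [A].  Applying this [O(log k)] times (as Fox and Sudakov do for
    graphs) gives a sequence of more than [2 k] sets of size
    [|U| 2^(-O(k log^2 k))] with almost all edges pointing forward.  Reordered
    suitably, [P_k] has pairwise disjoint backward edges, so it can be embedded
    greedily in this sequence, unless for some two of the sets the remaining
    candidates contain [A], [B] of comparable size with all edges going from [A]
    to [B].  Iterating inside [A] and [B] yields transitive subtournaments of
    order [n^(1 / O(k log^2 k))]. *)
Require Import Defs.
From mathcomp Require Import all_boot all_order all_algebra.
From mathcomp Require Import all_classical all_reals all_analysis.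
From mathcomp Require Import zify ring.
Import Order.TTheory GRing.Theory Num.Theory.
Import numFieldNormedType.Exports.
Set Implicit Arguments.
Unset Strict Implicit.
Unset Printing Implicit Defensive.

(** * Averaging over finite sets *)

Lemma leq_card_bigcup (I T : finType) (F : I -> {set T}) :
  #|\bigcup_i F i| <= \sum_i #|F i|.
Proof.
apply: (big_ind2 (fun (A : {set T}) n => #|A| <= n)) => [|A1 n1 A2 n2 h1 h2|//].
  by rewrite cards0.
exact: leq_trans (leq_card_setU _ _) (leq_add h1 h2).
Qed.

(** Markov's inequality: each [i] excludes at most a fraction [1 / (2 |I|)] of [B], so the union
    bound leaves half of [B]. *)
Lemma card_filter_bounded (T I : finType) (B : {set T}) (F : I -> T -> nat)
    (M : I -> nat) :
  (forall i, 2 * #|I| * \sum_(b in B) F i b <= #|B| * M i) ->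
  #|B| <= 2 * #|[set b in B | [forall i, F i b <= M i]]|.
Proof.
move=> H.
set G := [set b in B | _].
pose Z i := [set b in B | M i < F i b].
have ZI i : 2 * #|I| * #|Z i| <= #|B|.
  (* Strictness gives the factor [(M i).+1], which can be cancelled even when [M i = 0]. *)
  have h1 : #|Z i| * (M i).+1 <= \sum_(b in B) F i b.
    rewrite -sum_nat_const [leqRHS](big_setID (Z i)) /=.
    apply: (leq_trans _ (leq_addr _ _)).
    rewrite (_ : B :&: Z i = Z i); last first.
      by apply/setP=> x; rewrite !inE; case: (x \in B).
    by apply: leq_sum => b; rewrite inE => /andP[].
  have h2 := H i.
  have h3 : 2 * #|I| * (#|Z i| * (M i).+1) <= #|B| * M i.
    by apply: leq_trans h2; rewrite leq_mul2l h1 orbT.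
  rewrite -(leq_pmul2r (ltn0Sn (M i))).
  by apply: (@leq_trans (#|B| * M i)); [rewrite -mulnA | rewrite leq_mul2l leqnSn orbT].
have cov : B :\: G \subset \bigcup_i Z i.
  apply/fintype.subsetP => x; rewrite !inE => /andP[]; case xB: (x \in B) => //=.
  rewrite negb_forall => /existsP[i]; rewrite -ltnNge => hi _.
  by apply/bigcupP; exists i => //; rewrite inE xB.
have hc : #|B :\: G| <= \sum_i #|Z i|.
  exact: leq_trans (subset_leq_card cov) (leq_card_bigcup _).
have hs : 2 * #|I| * \sum_i #|Z i| <= #|I| * #|B|.
  by rewrite big_distrr /= -sum_nat_const; apply: leq_sum => i _.
have hh : 2 * \sum_i #|Z i| <= #|B|.
  case: (posnP #|I|) => [I0|Ip].
    rewrite big1 ?muln0 // => i _; by move: (fintype0 i I0).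
  by rewrite -(leq_pmul2l Ip) mulnCA mulnA.
have GB : G \subset B by apply/fintype.subsetP => x; rewrite inE => /andP[].
have := cardsID G B; rewrite (finset.setIidPr GB) => <-.
have := cardsID G B; rewrite (finset.setIidPr GB).
by move: hc hh; lia.
Qed.

(** * Pairs and sequences of sets with few backward edges *)

Section SparsePairs.
Variable T : tournament.
Implicit Types (A B U : {set T}) (x y : T).

Definition dir_edge (b : bool) x y := if b then edge x y else edge y x.

(* The number of edges from [B] to [A]. *)
Definition back A B := \sum_(b in B) #|[set a in A | edge b a]|.

Definition sparse q A B := q * back A B <= #|A| * #|B|.

Lemma backE A B : back A B = \sum_(a in A) #|[set b in B | edge b a]|.
Proof.
have E (P Q : pred T) : #|[set z in P | Q z]| = \sum_(z in P) Q z.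
  by rewrite -big_mkcondr -sum1_card; apply: eq_bigl => z; rewrite inE.
rewrite /back; under eq_bigr do rewrite E.
by rewrite exchange_big /=; apply: eq_bigr => a _; rewrite E.
Qed.

Lemma sparse_out q A B :
  (forall b, b \in B -> q * #|[set a in A | edge b a]| <= #|A|) -> sparse q A B.
Proof.
move=> H; rewrite /sparse /back big_distrr /= mulnC -sum_nat_const.
exact: leq_sum.
Qed.

Lemma sparse_in q A B :
  (forall a, a \in A -> q * #|[set b in B | edge b a]| <= #|B|) -> sparse q A B.
Proof.
move=> H; rewrite /sparse backE big_distrr /= -sum_nat_const.
exact: leq_sum.
Qed.

(* The sets [V j] may all be equal: the arcs force [w] to be injective, so no
   partition of [U] is needed, and [A], [B] need not be disjoint. *)
Lemma embed_or_sparse_pair (x0 : T) k q m U : 0 < q -> 0 < m ->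
  forall r (h : nat -> nat -> bool) (V : nat -> {set T}), r <= k ->
  (forall j, j < r -> V j \subset U) ->
  (forall j, j < r -> q ^ r * (k * m) <= #|V j|) ->
  (exists w : nat -> T, (forall j, j < r -> w j \in V j) /\
     forall i j, i < j -> j < r -> dir_edge (h i j) (w i) (w j)) \/
  exists A B, [/\ A \subset U, B \subset U, m <= #|A|, m <= #|B| & sparse q A B].
Proof.
move=> q0 m0; elim=> [|r IH] h V rk VU Vc.
  by left; exists (fun=> x0).
pose nb x j := [set y in V j.+1 | dir_edge (h 0 j.+1) x y].
(* A vertex that keeps a [1 / q] share of every later set is taken as the first image; the later
   sets shrink by [q]. *)
case: (boolP [exists x in V 0, [forall j : 'I_r, #|V j.+1| <= q * #|nb x j|]]).
  case/exists_inP => x xV /forallP hx.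
  case: (IH (fun i j => h i.+1 j.+1) (nb x)).
  - exact: ltnW.
  - move=> j jr; apply: fintype.subset_trans (VU j.+1 jr).
    by apply/fintype.subsetP => y; rewrite inE => /andP[].
  - move=> j jr; rewrite -(leq_pmul2l q0) mulnA -expnS.
    exact: leq_trans (Vc j.+1 jr) (hx (Ordinal jr)).
  - case=> w [wV we]; left; exists (fun i => if i is i'.+1 then w i' else x); split.
      by case=> // j jr; have := wV j jr; rewrite inE => /andP[].
    case=> [|i] [|j] //= ij jr; last exact: we.
    by have := wV j jr; rewrite inE => /andP[].
  - by right.
(* Every [x] now fails for some [j]. The factor [k] in the size bound lets the pigeonhole principle
   find [m] vertices failing for the same [j]. *)
rewrite negb_exists_in => /forall_inP Hno; right.
pose Z (j : 'I_r) := [set x in V 0 | q * #|nb x j| < #|V j.+1|].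
have cov : V 0 \subset \bigcup_j Z j.
  apply/fintype.subsetP => x xV; have := Hno x xV.
  rewrite negb_forall => /existsP[j]; rewrite -ltnNge => hj.
  by apply/bigcupP; exists j => //; rewrite inE xV.
have hc : #|V 0| <= \sum_j #|Z j|.
  exact: leq_trans (subset_leq_card cov) (leq_card_bigcup _).
have km : k * m <= q ^ r.+1 * (k * m) by rewrite leq_pmull // expn_gt0 q0.
have [j hj] : exists j, m <= #|Z j|.
  apply/existsP; apply: contraT; rewrite negb_exists => /forallP hno.
  have : \sum_j #|Z j| <= r * m.
    rewrite -[r in r * m]card_ord -sum_nat_const; apply: leq_sum => j _.
    by apply: ltnW; rewrite ltnNge.
  have := Vc 0 isT; have : r * m < k * m by rewrite ltn_pmul2r.
  by lia.
have jr : j.+1 < r.+1 by exact: ltn_ord.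
have mV : m <= #|V j.+1|.
  apply: leq_trans (Vc _ jr); apply: leq_trans km.
  by rewrite leq_pmull //; apply: leq_trans rk.
have ZU : Z j \subset U.
  apply: fintype.subset_trans (VU 0 isT).
  by apply/fintype.subsetP => y; rewrite inE => /andP[].
(* The direction that is rare between [Z j] and [V j.+1] decides which of them comes first. *)
case E : (h 0 j.+1).
  exists (V j.+1), (Z j); split => //; first exact: VU.
  by apply: sparse_out => b; rewrite inE /nb E => /andP[_ /ltnW].
exists (Z j), (V j.+1); split => //; first exact: VU.
by apply: sparse_in => b; rewrite inE /nb E => /andP[_ /ltnW].
Qed.

(** Doubling: take a sparse pair in [U] and recurse in both sets. Sparsity is not inherited by
    subsets, but a bound on the degree of every single vertex is, so each set is first cleaned at
    the cost of half its elements. *)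
Lemma sparse_family q K D :
  (forall U m, 0 < m -> D * m <= #|U| ->
    exists A B, [/\ A \subset U, B \subset U, m <= #|A|, m <= #|B| &
                 sparse (4 * K * q) A B]) ->
  forall l, 2 ^ l <= K -> forall U m, 0 < m -> (2 * D) ^ l * m <= #|U| ->
  exists X : nat -> {set T},
    (forall i, i < 2 ^ l -> X i \subset U /\ m <= #|X i|) /\
    forall i j, i < j -> j < 2 ^ l -> sparse q (X i) (X j).
Proof.
move=> Hp; elim=> [|l IH] lK U m m0 hU.
  exists (fun=> U); split; last by case=> [|i] [|j].
  by move=> i _; split=> //; rewrite expn0 mul1n in hU.
have lK' : 2 ^ l <= K by apply: leq_trans lK; rewrite leq_exp2l.
(* For [D = 0] the hypothesis would put a nonempty set inside the empty one. *)
have D0 : (D == 0) = false.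
  apply/negP => /eqP D0; have [] := Hp finset.set0 1 isT; first by rewrite D0.
  by move=> A [B [A0 _]]; rewrite finset.subset0 in A0; rewrite (eqP A0) cards0.
pose M := (2 * D) ^ l * m.
have M0 : 0 < M by rewrite muln_gt0 expn_gt0 m0 muln_gt0 /= lt0n D0.
have [||A [B [AU BU Ac Bc sAB]]] := Hp U (2 * M).
- by rewrite muln_gt0.
- by apply: leq_trans hU; rewrite /M expnS; apply: eq_leq; lia.
(* A single condition, hence the index type ['I_1]. Of the parameter [4 * K * q], a factor 2 is
   spent here and [2 * K] below, on the at most [K] sets [X i]. *)
pose A' := [set a in A |
  [forall i : 'I_1, 2 * K * q * #|[set b in B | edge b a]| <= #|B|]].
have A'c : #|A| <= 2 * #|A'|.
  apply: (card_filter_bounded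
           (F := fun (i : 'I_1) a => 2 * K * q * #|[set b in B | edge b a]|)
           (M := fun=> #|B|)) => _.
  rewrite card_ord -big_distrr /= -backE; apply: leq_trans sAB.
  by apply: eq_leq; lia.
have {}A'c : M <= #|A'| by lia.
have [X [XA XX]] := IH lK' A' m m0 A'c.
have sXB i : i < 2 ^ l -> sparse (2 * K * q) (X i) B.
  move=> il; apply: sparse_in => a aX.
  have := fintype.subsetP (XA i il).1 a aX; rewrite inE => /andP[_ /forallP/(_ ord0)].
  done.
(* [B] is cleaned only once the [X i] are known, against each of them. *)
pose B' := [set b in B |
  [forall i : 'I_(2 ^ l), q * #|[set a in X i | edge b a]| <= #|X i|]].
have B'c : #|B| <= 2 * #|B'|.
  apply: (card_filter_bounded
           (F := fun (i : 'I_(2 ^ l)) b => q * #|[set a in X i | edge b a]|)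
           (M := fun i : 'I_(2 ^ l) => #|X i|)) => i.
  rewrite card_ord -big_distrr /= -/(back (X i) B) [#|B| * _]mulnC.
  apply: leq_trans (sXB i (ltn_ord i)).
  by rewrite mulnA leq_mul2r leq_mul2r leq_mul2l lK' !orbT.
have {}B'c : M <= #|B'| by lia.
have [Y [YB YY]] := IH lK' B' m m0 B'c.
have sXY i j : i < 2 ^ l -> j < 2 ^ l -> sparse q (X i) (Y j).
  move=> il jl; apply: sparse_out => b bY.
  by have := fintype.subsetP (YB j jl).1 b bY; rewrite inE => /andP[_ /forallP/(_ (Ordinal il))].
have A'U : A' \subset U.
  by apply: fintype.subset_trans AU; apply/fintype.subsetP => x; rewrite inE => /andP[].
have B'U : B' \subset U.
  by apply: fintype.subset_trans BU; apply/fintype.subsetP => x; rewrite inE => /andP[].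
have e2 : 2 ^ l.+1 = 2 ^ l + 2 ^ l by rewrite expnS; lia.
exists (fun i => if i < 2 ^ l then X i else Y (i - 2 ^ l)); rewrite e2; split=> [i il|i j ij jl].
  case: ltnP => h.
    by have [h1 h2] := XA i h; split=> //; apply: fintype.subset_trans A'U.
  have [|h1 h2] := YB (i - 2 ^ l); first by lia.
  by split=> //; apply: fintype.subset_trans B'U.
case: (ltnP i) => hi; case: (ltnP j) => hj.
- exact: XX.
- by apply: sXY => //; lia.
- by exfalso; lia.
- by apply: YY; lia.
Qed.

End SparsePairs.

(** * From a sparse sequence to a complete pair *)

Lemma exists_subset_card (T : finType) (A : {set T}) m :
  m <= #|A| -> exists2 B : {set T}, B \subset A & #|B| = m.
Proof.
move=> mA; exists [set x in take m (enum A)].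
  apply/fintype.subsetP => x; rewrite inE => /mem_take.
  by rewrite mem_enum.
rewrite cardsE (card_uniqP _) ?take_uniq ?enum_uniq // size_take -cardE.
by case: ltngtP mA.
Qed.

Section CompletePairs.
Variable T : tournament.
Implicit Types (A B U : {set T}) (x y : T).

Definition complete_to A B := forall a b, a \in A -> b \in B -> edge a b.

Lemma not_edgeW x y : x != y -> ~~ edge y x -> edge x y.
Proof. by move=> xy /negbTE yx; have := edge_xor xy; rewrite yx addbF. Qed.

(* [x] lies in the [i]-th and [y] in the [j]-th set of a sequence in which most
   edges go forward. *)
Definition misdirected (i j : nat) x y :=
  if i < j then edge y x else (j < i) && edge x y.

(** Averaging over [K] conditions costs the factor [2 * K]. Degrees are measured into the whole
    [X j], not into [Y j], so all sets can be cleaned independently. *)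
Lemma clean_family (X : nat -> {set T}) K c :
  (forall i j, i < j -> j < K -> sparse (2 * K * c) (X i) (X j)) ->
  exists Y : nat -> {set T}, forall i, i < K ->
    [/\ Y i \subset X i, #|X i| <= 2 * #|Y i| &
      forall x j, x \in Y i -> j < K ->
        c * #|[set y in X j | misdirected i j x y]| <= #|X j|].
Proof.
move=> sX.
exists (fun i => [set x in X i |
  [forall j : 'I_K, c * #|[set y in X j | misdirected i j x y]| <= #|X j|]]).
move=> i iK; split.
- by apply/fintype.subsetP => x; rewrite inE => /andP[].
- apply: (card_filter_bounded
           (F := fun (j : 'I_K) x => c * #|[set y in X j | misdirected i j x y]|)
           (M := fun j : 'I_K => #|X j|)) => j.
  rewrite card_ord -big_distrr /= mulnA /misdirected.
  case: (ltngtP i j) => ij.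
  + by have := sX i j ij (ltn_ord j); rewrite /sparse backE.
  + by have := sX j i ij iK; rewrite /sparse /back [#|X j| * _]mulnC.
  + rewrite big1 ?muln0 // => x _; apply/eqP; rewrite cards_eq0.
    by apply/eqP/setP => y; rewrite !inE andbF.
- by move=> x j; rewrite inE => /andP[_ /forallP h] jK; exact: (h (Ordinal jK)).
Qed.

(* Listed as w_0, w_2, w_1, w_4, w_3, w_6, ..., the directed path has only the
   pairwise disjoint backward edges w_(2j+1) -> w_(2j). *)
Definition path_pos i := if odd i then i.+2 else i.

(** The vertices [w (2 * p')] and [w (2 * p' + 1)] are chosen together, at positions [2 * p'] and
    [2 * p' + 3]; only the edge between them must go backward. If the two candidate sets offer no
    such edge, they contain a complete pair. *)
Lemma embed_or_complete_pair (x0 : T) (X : nat -> {set T}) U K m p :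
  2 * p + 2 <= K ->
  (forall i, i < K -> X i \subset U /\ 4 * (2 * m + K) <= #|X i|) ->
  (forall i j, i < j -> j < K -> sparse (8 * K ^ 2) (X i) (X j)) ->
  (exists w : nat -> T,
     forall i j, i < j -> j < 2 * p -> dir_edge (j != i.+1) (w i) (w j)) \/
  exists A B, [/\ A \subset U, B \subset U, m <= #|A|, m <= #|B| & complete_to A B].
Proof.
move=> pK XU sX.
have K0 : 0 < K by lia.
have [Y HY] : exists Y : nat -> {set T}, forall i, i < K ->
    [/\ Y i \subset X i, #|X i| <= 2 * #|Y i| &
      forall x j, x \in Y i -> j < K ->
        4 * K * #|[set y in X j | misdirected i j x y]| <= #|X j|].
  apply: clean_family => i j ij jK.
  by have := sX i j ij jK; rewrite (_ : 8 * K ^ 2 = 2 * K * (4 * K)) //; lia.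
suff : forall p', p' <= p -> (exists w : nat -> T,
     (forall i, i < 2 * p' -> w i \in Y (path_pos i)) /\
     forall i j, i < j -> j < 2 * p' -> dir_edge (j != i.+1) (w i) (w j)) \/
  exists A B, [/\ A \subset U, B \subset U, m <= #|A|, m <= #|B| & complete_to A B].
  move=> /(_ p (leqnn p)) [[w [_ h]]|]; last by right.
  by left; exists w.
elim=> [_|p' IH pp]; first by left; exists (fun=> x0).
case: IH => [|[w [wY we]]|]; [exact: ltnW | | by right].
have posK i : i < 2 * p' -> path_pos i < K by rewrite /path_pos; case: (odd i); lia.
pose cand a := [set y in Y a |
  [forall i : 'I_(2 * p'), (y != w i) && ~~ misdirected (path_pos i) a (w i) y]].
(* [Y a] is at least half of [X a]. The fewer than [K] chosen vertices exclude at most a quarter of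
   [X a] by misdirected edges, and also themselves, as the sets may overlap. Hence [2 * m]
   candidates remain. *)
have candc a : a < K -> 2 * m <= #|cand a|.
  move=> aK; have [YX cY dY] := HY a aK.
  pose Z (i : 'I_(2 * p')) := w i |: [set y in X a | misdirected (path_pos i) a (w i) y].
  have cov : Y a \subset cand a :|: \bigcup_i Z i.
    apply/fintype.subsetP => y yY; rewrite finset.in_setU inE yY /=.
    case: (boolP [forall i : 'I_(2 * p'), _]) => //=.
    rewrite negb_forall => /existsP[i hi]; apply/bigcupP; exists i => //.
    rewrite !inE (fintype.subsetP YX _ yY) /=.
    by move: hi; rewrite negb_and !negbK.
  have hc : #|\bigcup_i Z i| <= \sum_i #|Z i|. exact: leq_card_bigcup.
  have hs : 4 * K * \sum_i #|Z i| <= 2 * p' * (4 * K + #|X a|).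
    rewrite -[X in X * (_ + _)]card_ord -sum_nat_const big_distrr /=; apply: leq_sum => i _.
    have iK := posK i (ltn_ord i).
    have [_ _ /(_ (w i) a (wY i (ltn_ord i)) aK) h] := HY _ iK.
    apply: (@leq_trans (4 * K * (1 + #|[set y in X a | misdirected (path_pos i) a (w i) y]|))).
      by rewrite leq_mul2l /Z cardsU1 leq_add2r leq_b1 orbT.
    by rewrite mulnDr muln1 leq_add2l.
  have hs2 : 4 * \sum_i #|Z i| <= 4 * K + #|X a|.
    rewrite -(leq_pmul2l K0); apply: (@leq_trans (2 * p' * (4 * K + #|X a|))).
      by apply: leq_trans hs; rewrite mulnCA mulnA.
    by rewrite leq_mul2r; apply/orP; right; lia.
  have h1 := leq_trans (subset_leq_card cov) (leq_card_setU _ _).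
  have [_ h2] := XU a aK.
  lia.
have candU a : a < K -> cand a \subset U.
  move=> aK; have [YX _ _] := HY a aK; apply: fintype.subset_trans (XU a aK).1.
  apply: fintype.subset_trans YX; by apply/fintype.subsetP => y; rewrite inE => /andP[].
have od : odd (2 * p') = false by rewrite mul2n odd_double.
have aK : 2 * p' < K by lia.
have bK : (2 * p').+3 < K by lia.
case: (boolP [exists x in cand (2 * p'), [exists y in cand (2 * p').+3, edge y x]]); last first.
  rewrite negb_exists_in => /forall_inP hno; right.
  (* The candidate sets may meet, so [A] is cut down to [m] elements and removed from the other set;
     this is why [2 * m] candidates were kept. *)
  have [A AC Am] := exists_subset_card (leq_trans (leq_pmull m (isT : 0 < 2)) (candc _ aK)).
  exists A, (cand (2 * p').+3 :\: A); split; rewrite ?Am //.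
  - exact: fintype.subset_trans AC (candU _ aK).
  - by apply: fintype.subset_trans (candU _ bK); exact: finset.subsetDl.
  - have := candc _ bK; have := cardsID A (cand (2 * p').+3).
    by have := subset_leq_card (finset.subsetIr (cand (2 * p').+3) A); lia.
  - move=> a b aA; rewrite finset.in_setD => /andP[bA bC].
    have := hno a (fintype.subsetP AC _ aA).
    rewrite negb_exists_in => /forall_inP /(_ b bC); apply: not_edgeW.
    by apply: contraNneq bA => <-.
case/exists_inP => x xC /exists_inP[y yC yx]; left.
have := xC; rewrite inE => /andP[xY /forallP xW].
have := yC; rewrite inE => /andP[yY /forallP yW].
exists (fun i => if i < 2 * p' then w i else if i == 2 * p' then x else y); split.
  move=> i hi; case: (ltnP i) => h1; first exact: wY.
  rewrite /path_pos; case: eqP => h2; first by rewrite h2 od.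
  have -> : i = (2 * p').+1 by lia.
  by rewrite /= od.
move=> i j ij; rewrite mulnS => hj.
case: (ltnP j) => h1; first by rewrite (ltn_trans ij h1); exact: we.
have hpos : i < 2 * p' -> path_pos i < (2 * p').+2 /\ (i.+1 != 2 * p' -> path_pos i < 2 * p').
  rewrite /path_pos => hi; split; first by case: (odd i); lia.
  move=> hi2; case: (boolP (odd i)) => // io.
  have : i.+2 != 2 * p'.
    by apply/eqP => h; have := congr1 odd h; rewrite mul2n odd_double /= negbK io.
  lia.
have [h2|h2] : j = 2 * p' \/ j = (2 * p').+1 by lia.
  subst j; rewrite ij eqxx.
  have /andP[xw] := xW (Ordinal ij); rewrite /misdirected /=.
  have [hp1 hp2] := hpos ij.
  (* The predecessor [w (2 * p' - 1)] sits one position after [x], so the forward edge between them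
     is the required path edge. *)
  case: (eqVneq i.+1 (2 * p')) => h.
    have -> : path_pos i = i.+2.
      by rewrite /path_pos; move: (congr1 odd h); rewrite mul2n odd_double /=; case: (odd i).
    rewrite -h ltnNge leqnSn /= ltnSn /= => ne.
    by apply: not_edgeW.
  rewrite hp2 // => ne; apply: not_edgeW => //.
  by rewrite eq_sym.
subst j; rewrite (_ : (2 * p').+1 == 2 * p' = false); last by lia.
case: (ltnP i) => h3.
  have /andP[yw] := yW (Ordinal h3); rewrite /misdirected /=.
  have [hp1 _] := hpos h3.
  rewrite (_ : path_pos i < (2 * p').+3); last by lia.
  move=> ne; rewrite (_ : (2 * p').+1 != i.+1); last by lia.
  by apply: not_edgeW => //; rewrite eq_sym.
have -> : i = 2 * p' by lia.
by rewrite !eqxx.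
Qed.

End CompletePairs.

(** * Transitive subtournaments as lists *)

Section TransitiveLists.
Variable T : tournament.

Lemma edge_asym (x y : T) : edge x y -> ~~ edge y x.
Proof.
move=> xy; case: (eqVneq x y) xy => [->|/edge_xor]; first by rewrite edge_irr.
by move=> + xy; rewrite xy.
Qed.

Lemma pairwise_edge_uniq (s : seq T) : pairwise (@edge T) s -> uniq s.
Proof.
elim: s => //= x s IH /andP[/allP h /IH ->]; rewrite andbT.
by apply/negP => /h; rewrite edge_irr.
Qed.

(** On a cycle, the vertex that comes first in [s] would receive an edge from itself or from a later
    one. *)
Lemma pairwise_edge_transitive (s : seq T) :
  pairwise (@edge T) s -> transitive_tournament (Defs.induced [set x in s]).
Proof.
move=> ps [c [c0 /andP[cyc uc]]].
have [x0 x0c] : exists x, x \in c by case: c c0 {cyc uc} => // x c; exists x; rewrite mem_head.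
pose x := [arg min_(y < x0 | y \in c) index (val y) s].
have [xc xmin] : x \in c /\ forall y, y \in c -> index (val x) s <= index (val y) s.
  by rewrite /x; case: arg_minnP.
have e1 : edge (val (prev c x)) (val x) by exact: (prev_cycle cyc xc).
have h1 : index (val x) s <= index (val (prev c x)) s by apply: xmin; rewrite mem_prev.
have ms (y : {y : T | y \in [set z in s]}) : val y \in s by have := valP y; rewrite inE.
move: h1; rewrite leq_eqVlt => /orP[/eqP h|h].
  move/(congr1 (nth (val x) s)): h; rewrite !nth_index // => h.
  by move: e1; rewrite -h edge_irr.
have := (pairwiseP (val x) ps) (index (val x) s) (index (val (prev c x)) s).
rewrite !inE !index_mem !ms => /(_ isT isT h); rewrite !nth_index //.
by move=> e2; move: (edge_asym e1); rewrite e2.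
Qed.

(** Without 3-cycles the edge relation is transitive on [S], so sorting by it gives the list. *)
Lemma transitive_pairwise_edge (S : {set T}) :
  transitive_tournament (Defs.induced S) ->
  exists s : seq T, pairwise (@edge T) s /\ size s = #|S|.
Proof.
move=> tr.
pose le (x y : T) := (x == y) || edge x y.
have le_tot : total le.
  move=> x y; rewrite /le; case: (eqVneq x y) => //= xy.
  by have := edge_xor xy; case: (edge x y) => //= ->.
have tr3 x y z : x \in S -> y \in S -> z \in S -> edge x y -> edge y z -> edge x z.
  move=> xS yS zS xy yz; apply: contraT => xz; exfalso; apply: tr.
  have xny : x != y by apply: contraTneq xy => ->; rewrite edge_irr.
  have ynz : y != z by apply: contraTneq yz => ->; rewrite edge_irr.
  have xnz : x != z.
    by apply: contraTneq yz => <-; apply: edge_asym.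
  have zx : edge z x by apply: not_edgeW; rewrite // eq_sym.
  exists [:: exist _ x xS; exist _ y yS; exist _ z zS]; split => //.
  rewrite /ucycle /= /induced_edge /= xy yz zx /= !inE.
  by rewrite -!val_eqE /= negb_or xny xnz ynz.
have le_tr : {in S & &, transitive le}.
  move=> y x z yS xS zS; rewrite /le => /orP[/eqP -> //|xy] /orP[/eqP <-|yz].
    by rewrite xy orbT.
  by rewrite (tr3 x y z) ?orbT.
exists (sort le (enum S)); split; last by rewrite size_sort -cardE.
have aS : all (mem S) (sort le (enum S)).
  by apply/allP => x; rewrite mem_sort mem_enum.
have : sorted le (sort le (enum S)) by exact: sort_sorted.
rewrite (sorted_pairwise_in le_tr aS).
have : uniq (sort le (enum S)) by rewrite sort_uniq enum_uniq.
elim: (sort le (enum S)) => //= x s IH /andP[xs us] /andP[/allP h ps].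
rewrite IH // andbT; apply/allP => y ys.
by have := h y ys; rewrite /le; case: eqP => // xy; rewrite xy ys in xs.
Qed.

End TransitiveLists.

(** * The lower bound inside a path-free tournament *)

(** Links the sequences produced by the embedding lemmas to induced subtournaments: [w] is injective
    on indices below [k], since distinct ones are joined by an edge, and its inverse is the
    isomorphism. *)
Lemma path_free_no_embedding k (T : tournament) :
  tournament_free (path_tournament k) T ->
  ~ exists w : nat -> T,
      forall i j, i < j -> j < k -> dir_edge (j != i.+1) (w i) (w j).
Proof.
move=> fr [w hw].
have we (i j : 'I_k) : edge (w i) (w j) = path_edge i j.
  rewrite /path_edge; case: (ltngtP i j) => ij.
  - have := hw i j ij (ltn_ord j); rewrite /dir_edge; case: (_ != _) => //.
    by move/edge_asym/negbTE.
  - have := hw j i ij (ltn_ord i); rewrite /dir_edge.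
    by case: eqP => //= _ /edge_asym/negbTE.
  - by rewrite ij edge_irr; lia.
have wi : injective (fun i : 'I_k => w i).
  move=> i j /= wij; apply/eqP; apply: contraT => ij.
  have := path_edge_xor ij; rewrite -!we wij.
  by rewrite addbb.
pose S := [set w (nat_of_ord i) | i : 'I_k].
have wS (i : 'I_k) : w i \in S by apply/imsetP; exists i.
pose g (i : path_tournament k) : Defs.induced S := exist _ (w (nat_of_ord i)) (wS i).
have gi : injective g by move=> i j /(congr1 val) /=; apply: wi.
have gb : bijective g.
  apply: inj_card_bij => //; rewrite card_sig card_ord.
  by apply: leq_trans (leq_imset_card _ _) _; rewrite card_ord.
apply: (fr S); case: gb => f fg gf; exists f; split; first by exists g.
by move=> u v; rewrite -{2}[u]gf -{2}[v]gf /= /induced_edge /= we.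
Qed.

Section PathFree.
Variables (T : tournament) (k L : nat).
Hypothesis (k_gt0 : 0 < k) (kL : 2 * k + 2 <= 2 ^ L).
Hypothesis free : tournament_free (path_tournament k) T.
Implicit Types U : {set T}.

(** With [K = 2 ^ L], the factor [(32 * K ^ 3) ^ k * k] is the loss of [embed_or_sparse_pair] for
    [q = 4 * K * (8 * K ^ 2)]; it enters in each of [L] doublings. The factor [4 * (K + 2)] covers
    the final sets of size [4 * (2 * m + K)]. *)
Definition pair_ratio :=
  4 * (2 ^ L + 2) * (2 * ((32 * (2 ^ L) ^ 3) ^ k * k)) ^ L.

Lemma path_free_complete_pair U m : 0 < m -> pair_ratio * m <= #|U| ->
  exists A B : {set T},
    [/\ A \subset U, B \subset U, m <= #|A|, m <= #|B| & complete_to A B].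
Proof.
move=> m0; have := kL; set K := 2 ^ L => kK; rewrite /pair_ratio -/K => hU.
have K0 : 0 < K by rewrite expn_gt0.
have [x0 _] : exists x, x \in U.
  apply/set0Pn; rewrite -card_gt0; apply: leq_trans hU.
  by rewrite !muln_gt0 m0 expn_gt0 !muln_gt0 expn_gt0 muln_gt0 k_gt0 expn_gt0 K0 addn_gt0 K0.
have nfree := path_free_no_embedding free.
have Hp (V : {set T}) n : 0 < n -> ((32 * K ^ 3) ^ k * k) * n <= #|V| ->
    exists A B : {set T}, [/\ A \subset V, B \subset V, n <= #|A|, n <= #|B| &
                 sparse (4 * K * (8 * K ^ 2)) A B].
  move=> n0 hV; rewrite (_ : 4 * K * (8 * K ^ 2) = 32 * K ^ 3); last first.
    by rewrite !expnS expn0; lia.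
  have q0 : 0 < 32 * K ^ 3 by rewrite muln_gt0 expn_gt0 K0.
  have [//||[w [_ hw]]|//] := @embed_or_sparse_pair T x0 k (32 * K ^ 3) n V q0 n0
    k (fun i j => j != i.+1) (fun=> V) (leqnn k).
    by move=> j _; rewrite mulnA.
  by case: nfree; exists w.
have := @sparse_family T (8 * K ^ 2) K _ Hp L (leqnn _) U (4 * (2 * m + K)).
case; first by lia.
  apply: leq_trans hU; rewrite [leqRHS]mulnAC [leqRHS]mulnC leq_mul2l.
  by apply/orP; right; nia.
move=> X [XU sX].
(* Taking [p = k] embeds [2 * k] vertices, of which the first [k] are kept; this treats both
   parities of [k] at once. *)
case: (@embed_or_complete_pair T x0 X U K m k kK XU sX) => // [[w hw]].
by case: nfree; exists w => i j ij jk; apply: hw => //; lia.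
Qed.

(** Each complete pair costs a factor [pair_ratio] and doubles the list: one found in [A] is
    followed by one found in [B]. *)
Lemma path_free_transitive_list U h : pair_ratio ^ h <= #|U| ->
  exists s : seq T, [/\ {subset s <= U}, pairwise (@edge T) s & size s = 2 ^ h].
Proof.
elim: h U => [|h IH] U hU.
  have [x xU] : exists x, x \in U by apply/set0Pn; rewrite -card_gt0.
  by exists [:: x]; split => // y; rewrite inE => /eqP ->.
have D0 : 0 < pair_ratio.
  have : 0 < 2 ^ L by rewrite expn_gt0.
  by move=> K0; rewrite !muln_gt0 expn_gt0 !muln_gt0 expn_gt0 muln_gt0 k_gt0 expn_gt0 K0 addn_gt0 K0.
have [||A [B [AU BU Ac Bc AB]]] := @path_free_complete_pair U (pair_ratio ^ h).
- by rewrite expn_gt0 D0.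
- by rewrite -expnS.
have [s [sA sp ss]] := IH A Ac.
have [t [tB tp ts]] := IH B Bc.
exists (s ++ t); split.
- by move=> x; rewrite mem_cat => /orP[/sA|/tB]; apply: fintype.subsetP.
- rewrite pairwise_cat sp tp !andbT; apply/allrelP => x y /sA xA /tB yB.
  exact: AB.
- by rewrite size_cat ss ts expnS; lia.
Qed.

(** The exponent comes out as [3 + 2 L + 5 k L + 3 k L ^ 2 + L ^ 2], whose coefficients add up to
    14. *)
Lemma pair_ratio_bound : pair_ratio <= 2 ^ (14 * k * L ^ 2).
Proof.
have L0 : 0 < L by case: L kL => //; rewrite expn0; lia.
have k2 : k <= 2 ^ L by lia.
have h1 : 4 * (2 ^ L + 2) <= 2 ^ (3 + L).
  by rewrite expnD; lia.
have h2 : 2 * ((32 * (2 ^ L) ^ 3) ^ k * k) <= 2 ^ (1 + ((5 + L * 3) * k + L)).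
  rewrite expnD leq_mul2l /= expnD; apply: leq_mul => //.
  by rewrite [in leqRHS]expnM expnD expnM.
have h3 : (2 * ((32 * (2 ^ L) ^ 3) ^ k * k)) ^ L <= 2 ^ ((1 + ((5 + L * 3) * k + L)) * L).
  by rewrite [leqRHS]expnM leq_exp2r.
apply: leq_trans (leq_mul h1 h3) _.
rewrite -expnD leq_exp2l //.
nia.
Qed.

End PathFree.

(** * Random tournaments, by counting *)

Lemma card_set_ord n : #|{set 'I_n}| = 2 ^ n.
Proof. by rewrite -cardsT -powersetT card_powerset cardsT card_ord. Qed.

Section ColouredTournament.
Variables (n : nat) (f : {ffun {set 'I_n} -> bool}).

(** Colour [true] on [[set i; j]] directs the edge to the smaller vertex. Colouring all subsets
    makes the sample space a plain function type of size [2 ^ 2 ^ n]. *)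
Definition colour_edge : rel 'I_n :=
  fun i j => (i != j) && (f [set i; j] (+) (i < j)).

Lemma colour_edge_irr : irreflexive colour_edge.
Proof. by move=> i; rewrite /colour_edge eqxx. Qed.

Lemma colour_edge_xor i j : i != j -> colour_edge i j (+) colour_edge j i.
Proof.
move=> ij; rewrite /colour_edge ij eq_sym ij /= finset.setUC.
move: ij; rewrite -val_eqE /= neq_ltn.
by case: (f _); case: ltngtP.
Qed.

Definition colour_tournament : tournament :=
  Tournament colour_edge_irr colour_edge_xor.
End ColouredTournament.

Lemma card_agreeing_ffun (T : finType) (Q : {set T}) (f0 : {ffun T -> bool}) :
  #|[set f : {ffun T -> bool} | [forall x in Q, f x == f0 x]]| = 2 ^ #|~: Q|.
Proof.
pose F x : pred bool := if x \in Q then pred1 (f0 x) else predT.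
transitivity #|family F|.
  rewrite cardsE; apply: eq_card => f; rewrite !inE.
  apply/forall_inP/familyP => [h x|h x xQ].
    rewrite /F; case: ifP => // xQ; exact: h.
  by have := h x; rewrite /F xQ.
rewrite card_family foldrE big_map big_enum /= -prod_nat_const [LHS](bigID (mem Q)) /=.
rewrite big1 ?mul1n; last by move=> x xQ; rewrite /F xQ card1.
rewrite (eq_bigl (mem (~: Q))); last by move=> x; rewrite !inE.
apply: eq_bigr => x xQ; have /negbTE h : x \notin Q by rewrite -finset.in_setC.
by rewrite /F h card_bool.
Qed.

(** All colourings that direct [t] forward agree on the ['C(size t, 2)] pairs of its entries, so it
    suffices to count those agreeing there with a fixed one, [f0]. *)
Lemma card_colour_pairwise n (t : seq 'I_n) :
  #|[set f | pairwise (colour_edge f) t]| * 2 ^ 'C(size t, 2) <= 2 ^ 2 ^ n.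
Proof.
set F := [set f | _].
have [->|[f0 f0F]] := set_0Vmem F; first by rewrite cards0.
have ut : uniq t by apply: (@pairwise_edge_uniq (colour_tournament f0)); rewrite inE in f0F.
pose A := [set x in t]; pose Q := [set B : {set 'I_n} | B \subset A & #|B| == 2].
have cA : #|A| = size t by rewrite cardsE (card_uniqP _).
have cQ : #|Q| = 'C(size t, 2) by rewrite cards_draws cA.
have FQ : F \subset [set f : {ffun {set 'I_n} -> bool} | [forall B in Q, f B == f0 B]].
  apply/fintype.subsetP => f fF; rewrite inE; apply/forall_inP => B.
  rewrite inE => /andP[BA /cards2P[x [y [xy EB]]]].
  have [xt yt] : x \in t /\ y \in t.
    by split; have := fintype.subsetP BA; [move/(_ x)|move/(_ y)];
      rewrite EB !inE eqxx ?orbT => /(_ isT).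
  have same z z' : index z t < index z' t -> z \in t -> z' \in t ->
      f [set z; z'] = f0 [set z; z'].
    move=> lt zt z't.
    have H (g : {ffun {set 'I_n} -> bool}) : g \in F -> colour_edge g z z'.
      rewrite inE => /(pairwiseP z)/(_ (index z t) (index z' t)).
      by rewrite !inE !index_mem !nth_index // => /(_ zt z't lt).
    have /andP[_] := H _ fF; have /andP[_] := H _ f0F.
    by case: (z < z'); case: (f _); case: (f0 _).
  rewrite EB; apply/eqP; case: (ltngtP (index x t) (index y t)) => h.
  - exact: same.
  - by rewrite finset.setUC; exact: same.
  - by move/(congr1 (nth x t)): h; rewrite !nth_index // => h; rewrite h eqxx in xy.
apply: (@leq_trans (2 ^ #|~: Q| * 2 ^ #|Q|)).
  by rewrite cQ leq_mul2r -(card_agreeing_ffun Q f0) subset_leq_card ?orbT.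
by rewrite -expnD addnC cardsC card_set_ord.
Qed.

(** Erdős's union bound over the [n ^ r] tuples. *)
Lemma exists_tournament_no_pairwise n r : n ^ r < 2 ^ 'C(r, 2) ->
  exists T : tournament, #|T| = n /\
    forall t : seq T, pairwise (@edge T) t -> size t != r.
Proof.
move=> nr.
case: (boolP [exists f : {ffun {set 'I_n} -> bool},
    [forall t : r.-tuple 'I_n, ~~ pairwise (colour_edge f) t]]).
  case/existsP => f /forallP h; exists (colour_tournament f); split; first exact: card_ord.
  by move=> t pt; apply/eqP => st; have := h (tcast st (in_tuple t)); rewrite val_tcast pt.
rewrite negb_exists => /forallP h; exfalso.
pose F (t : r.-tuple 'I_n) := [set f : {ffun {set 'I_n} -> bool} | pairwise (colour_edge f) t].
have cov : finset.setT \subset \bigcup_t F t.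
  apply/fintype.subsetP => f _; have := h f; rewrite negb_forall => /existsP[t].
  by rewrite negbK => ft; apply/bigcupP; exists t => //; rewrite inE.
have hc : 2 ^ 2 ^ n <= \sum_t #|F t|.
  apply: (@leq_trans #|\bigcup_t F t|).
    by apply: leq_trans (subset_leq_card cov); rewrite cardsT card_ffun card_bool card_set_ord.
  exact: leq_card_bigcup.
have : (\sum_t #|F t|) * 2 ^ 'C(r, 2) <= n ^ r * 2 ^ 2 ^ n.
  rewrite big_distrl /= -[in leqRHS](card_ord n) -card_tuple card_ord -sum_nat_const.
  apply: leq_sum => t _; have := card_colour_pairwise t; by rewrite size_tuple.
apply/negP; rewrite -ltnNge.
apply: (@leq_trans (2 ^ 2 ^ n * 2 ^ 'C(r, 2))).
  by rewrite mulnC ltn_pmul2l // expn_gt0.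
by rewrite leq_mul2r hc orbT.
Qed.

(** The vertices [0, 2, ..., 2 r - 2] of the path are never consecutive, so all edges among them go
    forward. *)
Lemma path_free_of_no_pairwise k r (T : tournament) : r.*2.-1 <= k ->
  (forall t : seq T, pairwise (@edge T) t -> size t != r) ->
  tournament_free (path_tournament k) T.
Proof.
move=> rk nt S [f [[g fg gf] fe]].
case: (posnP r) => [r0|r0]; first by have := nt [::] isT; rewrite r0.
have lt i : i < r -> i.*2 < k by lia.
pose w (i : 'I_r) : T := val (g (Ordinal (lt i (ltn_ord i)))).
have : pairwise (@edge T) [seq w i | i <- enum 'I_r].
  rewrite pairwise_map; apply: (@sub_pairwise _ (fun i j : 'I_r => i < j)).
    move=> i j ij; rewrite /relpre /w /=.
    set a := Ordinal _; set b := Ordinal _.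
    have : @edge (path_tournament k) a b by rewrite /= /path_edge /= ltn_double ij; lia.
    by move=> eab; have := fe (g a) (g b); rewrite !gf eab => /esym.
  have : pairwise ltn [seq val i | i <- enum 'I_r].
    by rewrite val_enum_ord -(sorted_pairwise ltn_trans) iota_ltn_sorted.
  by rewrite pairwise_map.
by move/nt; rewrite size_map size_enum_ord eqxx.
Qed.

(** * Both bounds for a fixed path length *)

(** Choose [h] with [2 ^ (d h) <= |T| < 2 ^ (d (h + 1))]. Doubling the exponent absorbs the
    rounding, as [h + 1 <= 2 h] for [h > 0]; for [h = 0] a list of one or two vertices is enough. *)
Lemma path_free_transitive k L (T : tournament) :
  0 < k -> 2 * k + 2 <= 2 ^ L -> tournament_free (path_tournament k) T -> 0 < #|T| ->
  exists s : seq T, pairwise (@edge T) s /\ #|T| <= size s ^ (28 * k * L ^ 2).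
Proof.
move=> k0 kL free n0; set d := 14 * k * L ^ 2.
have -> : 28 * k * L ^ 2 = 2 * d by rewrite /d; lia.
have L0 : 0 < L by case: L kL {d} => //; rewrite expn0; lia.
have d0 : 0 < d by rewrite !muln_gt0 k0 L0.
have d1 : 1 < 2 ^ d by rewrite -{1}(expn0 2) ltn_exp2l.
have /andP[hlo hhi] := trunc_log_bounds d1 n0.
set h := trunc_log _ _ in hlo hhi.
case: (posnP h) => [h0|h0].
  rewrite h0 expn1 in hhi.
  case: (ltnP 1 #|T|) => [/card_gt1P[x [y [_ _ xy]]]|n1].
    have nT : #|T| <= 2 ^ (2 * d).
      by apply: leq_trans (ltnW hhi) _; rewrite leq_exp2l // leq_pmull.
    case: (boolP (edge y x)) => e; first by exists [:: y; x]; rewrite /= e.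
    by exists [:: x; y]; rewrite /= (not_edgeW xy e).
  have /card_gt0P[x _] := n0.
  by exists [:: x]; split => //=; rewrite exp1n.
have [|s [_ ps ss]] := @path_free_transitive_list T k L k0 kL free finset.setT h.
  rewrite cardsT; apply: leq_trans hlo.
  by rewrite leq_exp2r // pair_ratio_bound.
exists s; split => //; rewrite ss; apply: leq_trans (ltnW hhi) _.
by rewrite -!expnM leq_exp2l //; nia.
Qed.

Lemma exists_path_free_tournament k s : 4 * s + 3 <= k ->
  exists T : tournament, [/\ #|T| = 2 ^ s, tournament_free (path_tournament k) T &
    forall t : seq T, pairwise (@edge T) t -> size t <= 2 * s + 1].
Proof.
move=> sk.
(* For [r = 2 s + 2] the union bound reads [s (2 s + 2) < (s + 1) (2 s + 1)], and
   [2 r - 1 = 4 s + 3]. *)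
have [|T [cT nT]] := @exists_tournament_no_pairwise (2 ^ s) (2 * s + 2).
  rewrite -expnM ltn_exp2l // bin2 (_ : _ * _.-1 = ((s + 1) * (2 * s + 1)).*2); last by nia.
  by rewrite doubleK; nia.
exists T; split => //.
  by apply: path_free_of_no_pairwise nT; lia.
move=> t pt; rewrite leqNgt; apply/negP => st.
have := nT (take (2 * s + 2) t) (subseq_pairwise (take_subseq _ _) pt).
by rewrite size_take; case: ltngtP => //; lia.
Qed.

(** * Bounds on the Erdős-Hajnal coefficient *)

Local Open Scope ring_scope.
Local Open Scope classical_set_scope.

Lemma powR_inv_le (R : realType) (n s N : nat) : (0 < N)%N -> (n <= s ^ N)%N ->
  n%:R `^ (N%:R^-1) <= s%:R :> R.
Proof.
move=> N0 ns.
have -> : s%:R = (s ^ N)%:R `^ (N%:R^-1) :> R.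
  rewrite natrX -powR_mulrn ?ler0n // -powRrM mulfV ?powRr1 ?ler0n //.
  by rewrite pnatr_eq0 -lt0n.
by apply: ge0_ler_powR; rewrite ?nnegrE ?invr_ge0 ?ler0n // ler_nat.
Qed.

Lemma EH_path_ge (R : realType) k L : (0 < k)%N -> (2 * k + 2 <= 2 ^ L)%N ->
  (((28 * k * L ^ 2)%:R^-1)%:E <= EH_coefficient R (path_tournament k))%E.
Proof.
move=> k0 kL; apply: ereal_sup_ubound; exists ((28 * k * L ^ 2)%:R^-1) => //.
have L0 : (0 < L)%N by case: L kL => //; rewrite expn0; lia.
split=> [|T n0 free]; first by rewrite invr_ge0 ler0n.
have [s [ps hs]] := path_free_transitive k0 kL free n0.
exists [set x in s]%SET; split; first exact: pairwise_edge_transitive.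
rewrite cardsE (card_uniqP (pairwise_edge_uniq ps)).
by apply: powR_inv_le => //; rewrite !muln_gt0 k0 L0.
Qed.

(** An admissible [e] satisfies [2 ^ (s e) <= 2 s + 1 <= 2 ^ v]; take logarithms. *)
Lemma EH_path_le (R : realType) k s v :
  (0 < s)%N -> (4 * s + 3 <= k)%N -> (2 * s + 1 <= 2 ^ v)%N ->
  (EH_coefficient R (path_tournament k) <= (v%:R / s%:R)%:E)%E.
Proof.
move=> s0 sk sv; apply: ge_ereal_sup => _ [e [e0 He] <-]; rewrite lee_fin.
have [T [cT free short]] := exists_path_free_tournament sk.
have [|S [trS]] := He T _ free; first by rewrite cT expn_gt0.
have [t [pt <-]] := transitive_pairwise_edge trS.
rewrite cT => h1.
have h2 : (2 ^ s)%:R `^ e <= (2 ^ v)%:R :> R.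
  by apply: le_trans h1 _; rewrite ler_nat; apply: leq_trans sv; exact: short.
have ln20 : 0 < ln 2 :> R by rewrite ln_gt0 // ltr1n.
rewrite ler_pdivlMr ?ltr0n //.
have pos2 n : 0 < (2 ^ n)%:R :> R by rewrite ltr0n expn_gt0.
move: h2; rewrite -ler_ln ?posrE ?powR_gt0 //.
rewrite ln_powR !natrX !lnXn ?ltr0n // -[ln 2 *+ s]mulr_natr -[ln 2 *+ v]mulr_natr.
by rewrite mulrCA ler_pM2l.
Qed.

(** Uses [L = t + 2], with [28 (t + 2) ^ 2 <= 112 t ^ 2], and [v = t + 1]. The upper constant is
    generous, so that [k] times the coefficient lies between [1 / M] and [M] for a single
    [M = 112 t ^ 2]. *)
Lemma EH_path_bounds (R : realType) k (t := trunc_log 2 k) : (12 <= k)%N ->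
  ((112 * k * t ^ 2)%:R^-1%:E <= EH_coefficient R (path_tournament k)
     <= ((112 * t ^ 2)%:R / k%:R)%:E)%E.
Proof.
move=> k12.
have k0 : (0 < k)%N by lia.
have t3 : (3 <= t)%N by apply: trunc_log_max => //; apply: leq_trans k12.
have kt : (k < 2 ^ t.+1)%N by exact: trunc_log_ltn.
apply/andP; split.
  apply: le_trans (@EH_path_ge R k t.+2 k0 _); last by rewrite expnS; lia.
  rewrite lee_fin lef_pV2 ?posrE ?ltr0n ?muln_gt0 ?expn_gt0 ?k0 ?(ltn_trans _ t3) //.
  by rewrite ler_nat; nia.
pose s := ((k - 3) %/ 4)%N.
have ks : (k <= 8 * s)%N by rewrite /s; lia.
have sk : (4 * s + 3 <= k)%N by rewrite /s; lia.
apply: le_trans (@EH_path_le R k s t.+1 _ sk _) _; [by lia|by lia|].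
rewrite lee_fin ler_pdivrMr ?ltr0n; last by lia.
rewrite mulrAC ler_pdivlMr ?ltr0n // -!natrM ler_nat.
by nia.
Qed.

(** * The exponent and its limit *)

Lemma norm_ln_le (R : realType) (x M : R) : 0 < M -> M^-1 <= x -> x <= M ->
  `|ln x| <= ln M.
Proof.
move=> M0 h1 h2.
have x0 : 0 < x by apply: lt_le_trans h1; rewrite invr_gt0.
by rewrite ler_norml -lnV ?posrE // !ler_ln ?posrE ?invr_gt0 // h1.
Qed.

(** Any bound in [o(t)] would do; this one follows from [ln y <= y] applied to the fourth root of
    [256 t ^ 2]. *)
Lemma ln_mul_sqr_le (R : realType) (t : nat) : (0 < t)%N ->
  ln (112 * t ^ 2)%:R <= 16 * Num.sqrt t%:R :> R.
Proof.
move=> t0; set y : R := Num.sqrt t%:R.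
have y0 : 0 < y by rewrite sqrtr_gt0 ltr0n.
have y2 : y ^+ 2 = t%:R by rewrite sqr_sqrtr ?ler0n.
have h : (112 * t ^ 2)%:R <= (4 * y) ^+ 4 :> R.
  have -> : (4 * y) ^+ 4 = 256 * (y ^+ 2) ^+ 2 by ring.
  by rewrite y2 natrM natrX ler_wpM2r ?exprn_ge0 ?ler0n // ler_nat.
have y40 : 0 < 4 * y by rewrite mulr_gt0.
apply: (@le_trans _ _ (ln ((4 * y) ^+ 4))).
  by rewrite ler_ln ?posrE ?exprn_gt0 // ltr0n muln_gt0 expn_gt0 t0.
rewrite lnXn // -[ln _ *+ _]mulr_natr.
rewrite (_ : 16 * y = 4 * y * 4); last by ring.
by rewrite ler_wpM2r // ltW // ln_sublinear.
Qed.

Section Exponent.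
Variable R : realType.

Definition EH_path k : R := fine (EH_coefficient R (path_tournament k)).

(** Obtained by solving the desired identity for [o k], so that only convergence to 0 is left to
    prove. *)
Definition EH_exponent k : R := - ln (EH_path k) / ln k%:R - 1.

Lemma EH_pathK k : (12 <= k)%N ->
  EH_coefficient R (path_tournament k) = (EH_path k)%:E.
Proof.
move=> /(EH_path_bounds R)/andP[h1 h2]; rewrite /EH_path.
by case: (EH_coefficient R _) h1 h2.
Qed.

Lemma EH_path_gt0 k : (12 <= k)%N -> 0 < EH_path k.
Proof.
move=> k12; have /andP[+ _] := EH_path_bounds R k12.
rewrite EH_pathK // lee_fin; apply: lt_le_trans.
have t3 : (3 <= trunc_log 2 k)%N by apply: trunc_log_max => //; apply: leq_trans k12.
by rewrite invr_gt0 ltr0n !muln_gt0 (leq_trans _ k12) ?(leq_trans _ t3).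
Qed.

Lemma EH_pathE k : (12 <= k)%N -> EH_path k = 1 / (k%:R `^ (1 + EH_exponent k)).
Proof.
move=> k12; have k1 : 1 < k%:R :> R by rewrite ltr1n (leq_trans _ k12).
rewrite /EH_exponent addrC subrK /powR gt_eqF; last by apply: lt_trans k1.
rewrite divfK; last by rewrite gt_eqF // ln_gt0.
by rewrite expRN lnK ?posrE ?EH_path_gt0 // div1r invrK.
Qed.

(** The exponent is [- ln (k * EH_path k) / ln k], with numerator at most [16 * sqrt t] in absolute
    value and [ln k >= t * ln 2]. *)
Lemma EH_exponent_bound k (t := trunc_log 2 k) : (12 <= k)%N ->
  `|EH_exponent k| <= 16 / ln 2 / Num.sqrt t%:R.
Proof.
move=> k12.
have k0 : 0 < k%:R :> R by rewrite ltr0n (leq_trans _ k12).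
have k1 : 1 < k%:R :> R by rewrite ltr1n (leq_trans _ k12).
have lk0 : 0 < ln k%:R :> R by rewrite ln_gt0.
have t3 : (3 <= t)%N by apply: trunc_log_max => //; apply: leq_trans k12.
have t0 : (0 < t)%N by apply: leq_trans t3.
have l20 : 0 < ln 2 :> R by rewrite ln_gt0 // ltr1n.
have e0 := EH_path_gt0 k12.
have y0 : 0 < Num.sqrt t%:R :> R by rewrite sqrtr_gt0 ltr0n.
have y2 : Num.sqrt t%:R ^+ 2 = t%:R :> R by rewrite sqr_sqrtr ?ler0n.
have lkt : t%:R * ln 2 <= ln k%:R :> R.
  rewrite mulrC mulr_natr -lnXn ?ltr0n // ler_ln ?posrE ?exprn_gt0 // -natrX ler_nat.
  by apply: trunc_logP => //; apply: leq_trans k12.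
have /andP[] := EH_path_bounds R k12; rewrite -/t EH_pathK // !lee_fin => h1 h2.
have M0 : 0 < (112 * t ^ 2)%:R :> R by rewrite ltr0n !muln_gt0 t0.
have hln : `|ln (k%:R * EH_path k)| <= 16 * Num.sqrt t%:R.
  apply: le_trans (ln_mul_sqr_le R t0); apply: norm_ln_le => //.
    move: h1; rewrite (_ : (112 * k * t ^ 2 = k * (112 * t ^ 2))%N); last by lia.
    by rewrite natrM invfM mulrC ler_pdivrMr // mulrC.
  by move: h2; rewrite ler_pdivlMr // mulrC.
have -> : EH_exponent k = - ln (k%:R * EH_path k) / ln k%:R.
  rewrite /EH_exponent lnM ?posrE //; field; exact: lt0r_neq0.
rewrite normrM normrN normfV (gtr0_norm lk0) ler_pdivrMr //.
apply: (le_trans hln).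
have -> : 16 * Num.sqrt t%:R = 16 / ln 2 / Num.sqrt t%:R * (t%:R * ln 2) :> R.
  by rewrite -[X in _ * (X * ln 2)]y2; field; rewrite !lt0r_neq0.
by apply: ler_wpM2l lkt; rewrite !mulr_ge0 ?invr_ge0 ?ltW.
Qed.

End Exponent.

Theorem theorem3p5 (R : realType) :
  exists o : nat -> R,
    o k @[k --> \oo] --> (0 : R) /\
    \forall k \near \oo,
      EH_coefficient R (path_tournament k) = (1 / (k%:R `^ (1 + o k)))%:E.
Proof.
exists (EH_exponent R); split; last first.
  by exists 12%N => // k /= k12; rewrite EH_pathK // EH_pathE.
apply/cvgr0Pnorm_le => eps eps0.
set c : R := 16 / ln 2.
have c0 : 0 < c by rewrite divr_gt0 // ln_gt0 // ltr1n.
(* Chosen so that [t >= N] forces [sqrt t >= c / eps]; [k >= 2 ^ N] ensures [t >= N]. *)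
pose N := (Num.bound ((c / eps) ^+ 2)).+1.
exists (12 + 2 ^ N)%N => // k /= hk.
have k12 : (12 <= k)%N by apply: leq_trans hk; exact: leq_addr.
apply: le_trans (EH_exponent_bound R k12) _; rewrite -/c.
set t := trunc_log 2 k.
have Nt : (N <= t)%N by apply: trunc_log_max => //; apply: leq_trans hk; exact: leq_addl.
have t0 : (0 < t)%N by apply: leq_trans Nt.
have y0 : 0 < Num.sqrt t%:R :> R by rewrite sqrtr_gt0 ltr0n.
rewrite ler_pdivrMr // mulrC -ler_pdivrMr //.
have ce0 : 0 <= c / eps by rewrite divr_ge0 ?ltW.
rewrite -(ger0_norm ce0) -sqrtr_sqr ler_sqrt ?ler0n //.
apply: (@le_trans _ _ N%:R); last by rewrite ler_nat.
apply: ltW; apply: (lt_le_trans (archi_boundP _)); first exact: sqr_ge0.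
by rewrite ler_nat.
Qed.
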